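(* Let $(R,\mathfrak m,k)$ be a Noetherian local ring of Krull dimension $d$, let $E_R(k)$ be the injective envelope of the $R$-module $k=R/\mathfrak m$, and let $S:=R\ltimes E_R(k)$. Then the following statements hold: (i) $S$ is a weakly Laskerian ring. (ii) If $d\geq 1$, then the polynomial ring $S[X]$ is not weakly Laskerian for any indeterminate $X$ over $S$. (iii) If $d\geq 2$, then the formal power series ring $S[[X]]$ is not weakly Laskerian for any indeterminate $X$ over $S$.
   Context: All rings are commutative with identity. For an $R$-module $M$, $\operatorname{Ass}_R M$ denotes the set of prime ideals $\mathfrak p$ of $R$ of the form $\mathfrak p=(0:_R x)$ for some $x\in M$. An $R$-module $M$ is weakly Laskerian if $\operatorname{Ass}_R(M/N)$ is a finite set for every submodule $N$ of $M$. A ring is weakly Laskerian if it is weakly Laskerian as a module over itself. For an $R$-module $M$, the trivial ring extension (idealization) $R\ltimes M$ is the set $R\times M$ with addition $(r_1,m_1)+(r_2,m_2)=(r_1+r_2,m_1+m_2)$ and multiplication $(r_1,m_1)(r_2,m_2)=(r_1r_2,\,r_1m_2+r_2m_1)$; it is a commutative ring with identity $(1,0)$. *)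

(* Defs.v *)
From HB Require Import structures.
From mathcomp Require Import all_boot all_algebra.
From mathcomp Require Import boolp classical_sets functions cardinality.

Set Implicit Arguments.
Unset Strict Implicit.
Unset Printing Implicit Defensive.

Import GRing.Theory.

Local Open Scope quotient_scope.
Local Open Scope ring_scope.

(* Ideals and submodules are boolean predicates; since [boolp] makes every
   proposition decidable, this is no restriction. Equality of predicates is
   extensional. *)

(* [submodClosed] does not inherit from [zmodClosed]. *)
Definition submod_zmod (R : pzRingType) (M : lmodType R) (N : submodClosed M)
  : {pred M} := fun x => x \in N.

HB.instance Definition _ (R : pzRingType) (M : lmodType R) (N : submodClosed M)
  := GRing.isZmodClosed.Build M (submod_zmod N)
       (GRing.submod_closedB (submodClosedP N)).

(* The quotient module M / N, on the carrier of the quotient group. *)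
Definition quot_module (R : pzRingType) (M : lmodType R) (N : submodClosed M)
  : Type := Quotient.quot (submod_zmod N : zmodClosed M).

Section QuotModule.
Variables (R : pzRingType) (M : lmodType R) (N : submodClosed M).
Local Notation Q := (quot_module N).

HB.instance Definition _ := GRing.Zmodule.on Q.
HB.instance Definition _ :=
  ZmodQuotient.copy Q (Quotient.quot (submod_zmod N : zmodClosed M)).

Definition quot_scale (a : R) (x : Q) : Q := \pi_Q (a *: repr x).

Lemma quot_piP (x y : M) : reflect (\pi_Q x = \pi_Q y) (x - y \in N).
Proof. by apply: (iffP idP) => [xy|/eqP]; [apply/eqP|]; rewrite piE. Qed.

Lemma quot_piD (x y : M) : \pi_Q (x + y) = \pi_Q x + \pi_Q y.
Proof. exact: raddfD. Qed.

Lemma quot_scale_pi (a : R) (x : M) : quot_scale a (\pi_Q x) = \pi_Q (a *: x).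
Proof.
have xN : repr (\pi_Q x) - x \in N by apply/quot_piP; rewrite reprK.
by apply/quot_piP; rewrite -scalerBr; apply: rpredZ.
Qed.

Fact quot_scalerA (a b : R) (x : Q) :
  quot_scale a (quot_scale b x) = quot_scale (a * b) x.
Proof. by elim/quotW: x => x; rewrite (quot_scale_pi b) !quot_scale_pi scalerA. Qed.

Fact quot_scale1r : left_id 1 quot_scale.
Proof. by elim/quotW => x; rewrite quot_scale_pi scale1r. Qed.

Fact quot_scalerDr : right_distributive quot_scale +%R.
Proof.
move=> a; elim/quotW => x; elim/quotW => y.
by rewrite -quot_piD !quot_scale_pi scalerDr quot_piD.
Qed.

Fact quot_scalerDl (x : Q) : {morph quot_scale^~ x : a b / a + b}.
Proof. by elim/quotW: x => x a b; rewrite !quot_scale_pi scalerDl quot_piD. Qed.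

HB.instance Definition _ := GRing.Zmodule_isLmodule.Build R Q
  quot_scalerA quot_scale1r quot_scalerDr quot_scalerDl.

End QuotModule.

(* A (proper) ideal of R is a submodule of the R-module R. *)
Section IdealSubmodule.
Variables (R : comNzRingType) (I : idealr R).

Definition ideal_submod : {pred R^o} := fun x : R => x \in I.

Fact ideal_submod_closed : GRing.submod_closed ideal_submod.
Proof.
split=> [|a u v uI vI]; first exact: (idealr0 I).
by apply: (@rpredD _ I) => //; apply: idealMr.
Qed.

HB.instance Definition _ :=
  GRing.isSubmodClosed.Build R R^o ideal_submod ideal_submod_closed.

(* R / I as an R-module. *)
Definition residue_module : lmodType R :=
  quot_module (ideal_submod : submodClosed R^o).

End IdealSubmodule.

Section Ideals.
Variable R : comNzRingType.

(* [idealr_closed] includes properness (1 \notin p). *)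
Definition prime_ideal (p : {pred R}) : Prop :=
  idealr_closed p /\ prime_idealr_closed p.

Definition maximal_ideal (I : {pred R}) : Prop :=
  idealr_closed I /\
  forall J : {pred R}, idealr_closed J -> {subset I <= J} -> J =i I.

Definition local_ring (I : {pred R}) : Prop :=
  maximal_ideal I /\ forall J : {pred R}, maximal_ideal J -> J =i I.

Definition noetherian : Prop :=
  forall I : submodClosed R^o, exists s : seq R,
    forall x : R, x \in (I : {pred R}) <->
      exists c : nat -> R, x = \sum_(i < size s) c i * s`_i.

Definition prime_chain (n : nat) : Prop :=
  exists p : nat -> {pred R},
    (forall i, (i <= n)%N -> prime_ideal (p i)) /\
    (forall i, (i < n)%N ->
       {subset p i <= p i.+1} /\ ~ {subset p i.+1 <= p i}).

Definition krull_dim (d : nat) : Prop :=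
  prime_chain d /\ forall n, prime_chain n -> (n <= d)%N.

End Ideals.

Section Modules.
Variable R : comNzRingType.

Definition Ass (M : lmodType R) : set (pred R) :=
  [set p : pred R | prime_ideal p /\
     exists x : M, p =i [pred r : R | r *: x == 0]]%classic.

Definition weakly_laskerian (M : lmodType R) : Prop :=
  forall N : submodClosed M, finite_set (Ass (quot_module N)).

Definition injective_module (E : lmodType R) : Prop :=
  forall (A B : lmodType R) (f : {linear A -> B}) (g : {linear A -> E}),
    injective f -> exists h : {linear B -> E}, h \o f =1 g.

Definition essential_mono (A B : lmodType R) (f : {linear A -> B}) : Prop :=
  injective f /\
  forall N : submodClosed B, (exists2 y : B, y \in N & y != 0) ->
    exists2 a : A, f a \in N & f a != 0.

Definition injective_envelope (A E : lmodType R) (f : {linear A -> E}) : Prop :=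
  injective_module E /\ essential_mono f.

End Modules.

Definition weakly_laskerian_ring (R : comNzRingType) : Prop :=
  weakly_laskerian R^o.

Definition idealization (R : comNzRingType) (M : lmodType R) : Type :=
  (R * M)%type.

Section Idealization.
Variables (R : comNzRingType) (M : lmodType R).
Local Notation S := (idealization M).

HB.instance Definition _ := GRing.Zmodule.copy S (R * M)%type.

Definition idealization_one : S := (1, 0).
Definition idealization_mul (x y : S) : S :=
  (x.1 * y.1, x.1 *: y.2 + y.1 *: x.2).

Fact idealization_mulA : associative idealization_mul.
Proof.
move=> x y z; congr pair; first exact: mulrA.
by rewrite /= !scalerDr !scalerA addrA [z.1 * x.1]mulrC [z.1 * y.1]mulrC.
Qed.

Fact idealization_mulC : commutative idealization_mul.
Proof. by move=> x y; congr pair; [exact: mulrC | exact: addrC]. Qed.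

Fact idealization_mul1 : left_id idealization_one idealization_mul.
Proof.
by case=> r u; congr pair; rewrite /= ?mul1r // scale1r scaler0 addr0.
Qed.

Fact idealization_mulDl : left_distributive idealization_mul +%R.
Proof.
move=> x y z; congr pair; first exact: mulrDl.
by rewrite /= scalerDl scalerDr addrACA.
Qed.

Fact idealization_oner_neq0 : idealization_one != 0.
Proof. by apply/eqP=> -[/eqP]; rewrite oner_eq0. Qed.

HB.instance Definition _ := GRing.Zmodule_isComNzRing.Build S
  idealization_mulA idealization_mulC idealization_mul1 idealization_mulDl
  idealization_oner_neq0.

End Idealization.

(* R[[X]]: the sequence f stands for the sum of the f n X^n. *)
Definition power_series (R : comNzRingType) : Type := nat -> R.

Section PowerSeries.
Variable R : comNzRingType.
Local Notation P := (power_series R).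

HB.instance Definition _ := GRing.Zmodule.copy P (nat -> R).

Definition power_series_one : P := fun n => (n == 0%N)%:R.
Definition power_series_mul (f g : P) : P :=
  fun n => \sum_(i < n.+1) f i * g (n - i)%N.

(* The truncation of f below degree n, used to inherit the ring laws from
   {poly R}. *)
Definition power_series_trunc (n : nat) (f : P) : {poly R} :=
  \poly_(i < n) f i.

Lemma power_series_mul_trunc (m n : nat) (f g : P) : (n < m)%N ->
  power_series_mul f g n =
  (power_series_trunc m f * power_series_trunc m g)`_n.
Proof.
move=> nm; rewrite coefM; apply: eq_bigr => i _; rewrite !coef_poly.
rewrite (leq_ltn_trans (leq_subr _ _) nm).
by rewrite (leq_ltn_trans _ nm) // -ltnS.
Qed.

Fact power_series_mulC : commutative power_series_mul.
Proof.
move=> f g; apply/funext => n.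
by rewrite !(@power_series_mul_trunc n.+1) // mulrC.
Qed.

Fact power_series_mulA : associative power_series_mul.
Proof.
move=> f g h; apply/funext => n.
pose t := power_series_trunc n.+1.
transitivity ((t f * (t g * t h))`_n).
  rewrite coefM; apply: eq_bigr => i _; rewrite coef_poly ltn_ord.
  by rewrite (@power_series_mul_trunc n.+1) // ltnS leq_subr.
rewrite mulrA coefM; apply: eq_bigr => i _; rewrite [(t h)`__]coef_poly.
by rewrite (@power_series_mul_trunc n.+1) // ltnS leq_subr.
Qed.

Fact power_series_mul1 : left_id power_series_one power_series_mul.
Proof.
move=> f; apply/funext => n; rewrite /power_series_mul big_ord_recl /=.
rewrite /power_series_one eqxx mul1r subn0 big1 ?addr0 // => i _.
by rewrite mul0r.
Qed.

Fact power_series_mulDl : left_distributive power_series_mul +%R.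
Proof.
move=> f g h; apply/funext => n; rewrite /power_series_mul.
by rewrite -[RHS]big_split; apply: eq_bigr => i _; rewrite /= -mulrDl.
Qed.

Fact power_series_oner_neq0 : power_series_one != 0.
Proof.
apply/eqP => /(congr1 (fun f : P => f 0%N)) /eqP.
by rewrite /power_series_one eqxx oner_eq0.
Qed.

HB.instance Definition _ := GRing.Zmodule_isComNzRing.Build P
  power_series_mulA power_series_mulC power_series_mul1 power_series_mulDl
  power_series_oner_neq0.

End PowerSeries.

(* Main.v *)
(* Write S = R |x E with E the injective envelope of k. Every element of E is
   killed by a power of each element of m, so a prime of S associated to S/N
   either comes from Ass_R(R/I), where I is the image of N in R, or is the
   preimage of m; this gives (i).

   For (ii), filter E by its iterated socles L_n, which grow strictly when d >= 1
   since E is not killed by a power of a nonnilpotent element, and take pairwise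
   comaximal monic polynomials f_n with products F_n = f_0 ... f_(n-1). Modulo
   the ideal sum_n F_(n+1) L_(n+1)[X], an element F_n e_n with
   e_n in L_(n+1) \ L_n is nonzero and is killed by m and f_n, so some multiple
   of it has a prime annihilator containing f_n.

   For (iii), if d >= 2 then R has infinitely many primes p_i maximal among the
   primes different from m, by prime avoidance and Krull's principal ideal
   theorem. Choose c_i in m \ p_i and an increasing sequence of submodules T_n
   of E, with elements e_n of T_(n+1) killed by p_i and such that c_i^k e_n is
   not in T_n, where n runs through the codes of the pairs (i, k). Modulo the
   series whose n-th coefficient lies in T_n, the series y_i of the e_n X^n
   attached to i is killed by X and p_i but by no power of c_i, so some multiple
   of y_i by an element of R has annihilator the preimage of p_i. *)
Require Import Defs.
From HB Require Import structures.
From mathcomp Require Import all_boot all_algebra.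
From mathcomp Require Import boolp classical_sets functions cardinality.
Import GRing.Theory.
Local Open Scope quotient_scope.
Local Open Scope ring_scope.

Set Implicit Arguments.
Unset Strict Implicit.
Unset Printing Implicit Defensive.

(** * Submodules as sets, and projection onto the quotient *)

Definition is_submod {R : comNzRingType} {M : lmodType R} (N : set M) : Prop :=
  N 0 /\ forall a x y, N x -> N y -> N (a *: x + y).

Notation is_ideal I := (is_submod (I : set _^o)).

Section Submod.
Context {R : comNzRingType} {M : lmodType R} {N : set M}.
Hypothesis hN : is_submod N.

Lemma submod0 : N 0. Proof. by case: hN. Qed.

Lemma submodZ a x : N x -> N (a *: x).
Proof. by case: hN => N0 NZ Nx; rewrite -[_ *: _]addr0; apply: NZ. Qed.

Lemma submodD x y : N x -> N y -> N (x + y).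
Proof. by case: hN => N0 NZ Nx Ny; rewrite -[x]scale1r; apply: NZ. Qed.

Lemma submodN x : N x -> N (- x).
Proof. by rewrite -scaleN1r; apply: submodZ. Qed.

Lemma submodB x y : N x -> N y -> N (x - y).
Proof. by move=> Nx Ny; apply/submodD/submodN. Qed.

Lemma submod_subr x y : N (x - y) -> N y -> N x.
Proof. by move=> Nxy Ny; rewrite -(subrK y x); apply: submodD. Qed.

Lemma submod_sum I (r : seq I) (P : pred I) F :
  (forall i, P i -> N (F i)) -> N (\sum_(i <- r | P i) F i).
Proof. by move=> NF; apply: big_ind => //; [exact: submod0|exact: submodD]. Qed.

Lemma submod_pred_closed : GRing.submod_closed [pred x | `[< N x >]].
Proof.
split=> [|a x y]; first by apply/asboolP/submod0.
by move=> /asboolP Nx /asboolP Ny; apply/asboolP; case: hN => _; apply.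
Qed.

(** The closure proof is an argument so that the instance below can be attached to
    [submod_pred hN]. *)
Definition submod_pred of is_submod N : {pred M} := [pred x | `[< N x >]].

HB.instance Definition _ :=
  GRing.isSubmodClosed.Build R M (submod_pred hN) submod_pred_closed.

Definition submod_bundle : submodClosed M := submod_pred hN.

Lemma mem_submod x : x \in submod_bundle <-> N x.
Proof. by split=> /asboolP. Qed.

End Submod.

Lemma submodClosed_submod (R : comNzRingType) (M : lmodType R)
  (N : submodClosed M) : is_submod [set x | x \in N].
Proof. by split=> [|a x y] /=; [exact: rpred0|move=> *; rewrite rpredD ?rpredZ]. Qed.

Section QuotientProjection.
Context {R : comNzRingType} {M : lmodType R} (N : submodClosed M).

Lemma quot_piZ a (x : M) :
  a *: \pi_(quot_module N) x = \pi_(quot_module N) (a *: x).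
Proof. exact: quot_scale_pi. Qed.

Lemma quot_pi_eq0 (x : M) : (\pi_(quot_module N) x == 0) = (x \in N).
Proof.
have pi0 : 0 = \pi_(quot_module N) (0 : M) by rewrite raddf0.
by rewrite {1}pi0; apply/eqP/idP => [/quot_piP|xN]; [|apply/quot_piP]; rewrite subr0.
Qed.

Lemma quot_pi_surj (x : quot_module N) : exists y, x = \pi_(quot_module N) y.
Proof. by exists (repr x); rewrite reprK. Qed.

End QuotientProjection.

(** * Colon ideals, sums with a principal ideal, and primes *)

Section Ideal.
Context {R : comNzRingType}.
Implicit Types (I J P : set R) (a b x y : R).

Lemma ideal_mull I a x : is_ideal I -> I x -> I (a * x).
Proof. by move=> hI; apply: (submodZ (M := R^o)). Qed.

Lemma ideal_mulr I a x : is_ideal I -> I x -> I (x * a).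
Proof. by rewrite mulrC; apply: ideal_mull. Qed.

Definition colon I x : set R := [set r | I (r * x)].

Definition ideal_add I x : set R := [set r | exists a, I (r - a * x)].

Lemma colon_ideal I x : is_ideal I -> is_ideal (colon I x).
Proof.
move=> hI; split=> [|a u v]; rewrite /colon /= ?mul0r; first exact: submod0 hI.
by move=> Iu Iv; rewrite mulrDl -mulrA; apply: (submodD hI) => //; apply: ideal_mull.
Qed.

Lemma ideal_add_ideal I x : is_ideal I -> is_ideal (ideal_add I x).
Proof.
move=> hI; split=> [|a u v]; first by exists 0; rewrite mul0r subr0; exact: submod0 hI.
move=> [b Ib] [c Ic]; exists (a * b + c).
rewrite mulrDl opprD addrACA -mulrA -mulrBr.
by apply: (submodD hI) => //; apply: ideal_mull.
Qed.

Lemma sub_ideal_add I x : (I `<=` ideal_add I x)%classic.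
Proof. by move=> y Iy; exists 0; rewrite mul0r subr0. Qed.

Lemma mem_ideal_add I x : is_ideal I -> ideal_add I x x.
Proof. by move=> hI; exists 1; rewrite mul1r subrr; exact: submod0 hI. Qed.

Lemma sub_colon I x : is_ideal I -> (I `<=` colon I x)%classic.
Proof. by move=> hI y Iy; apply: ideal_mulr. Qed.

Definition is_prime P := [/\ is_ideal P, ~ P 1 & forall a b, P (a * b) -> P a \/ P b].

Lemma is_primeX P a n : is_prime P -> P (a ^+ n) -> P a.
Proof.
case=> _ P1 Pm; elim: n => [|n IHn]; first by rewrite expr0 => /P1.
by rewrite exprS => /Pm[].
Qed.

Lemma idealr_closedP (p : {pred R}) :
  idealr_closed p <-> is_ideal [set x | x \in p] /\ 1 \notin p.
Proof.
split=> [[p0 p1 pZ]|[[p0 pZ] p1]]; last first.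
  by split=> // a x y; apply: pZ.
by split=> //; split=> // a x y; apply: pZ.
Qed.

Lemma prime_idealP (p : {pred R}) : prime_ideal p <-> is_prime [set x | x \in p].
Proof.
split=> [[/idealr_closedP[hp p1] pM]|[hp p1 pM]]; split=> //.
- exact/negP.
- by move=> a b /pM /orP.
- by apply/idealr_closedP; split=> //; apply/negP.
- by move=> a b /pM /orP.
Qed.

(** Trades the quotient module for colon ideals, in terms of which associated primes are handled
    from here on. *)
Lemma AssP (N : submodClosed R^o) (p : pred R) :
  Ass (quot_module N) p <->
  is_prime [set x | x \in p] /\ exists x, forall r, r \in p <-> (r * x \in N).
Proof.
split=> -[/prime_idealP hp [x px]]; split=> //.
  have [y xy] := quot_pi_surj x; exists y => r.
  by rewrite px inE xy quot_piZ quot_pi_eq0.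
exists (\pi_(quot_module N) (x : R^o)) => r; apply/idP/idP.
  by rewrite inE quot_piZ quot_pi_eq0 => /px.
by rewrite inE quot_piZ quot_pi_eq0 => /px.
Qed.

End Ideal.

(** * Chain and maximum conditions *)

Section Noetherian.
Context {R : comNzRingType}.
Hypothesis hR : noetherian R.
Implicit Types (I J P Q : set R) (a b x y : R).

Lemma noetherian_acc (I : nat -> set R) :
  (forall n, is_ideal (I n)) -> (forall n, I n `<=` I n.+1)%classic ->
  exists n, forall k, (n <= k)%N -> I k = I n.
Proof.
move=> hI Isub.
have Imono n k : (n <= k)%N -> (I n `<=` I k)%classic.
  move/subnK=> <-; elim: (k - n)%N => // j IHj x /IHj; rewrite addSn; exact: Isub.
have hU : is_ideal [set x | exists n, I n x].
  split=> [|a x y [n In] [k Ik]]; first by exists 0%N; exact: submod0 (hI _).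
  exists (maxn n k); case: (hI (maxn n k)) => _; apply.
    exact: Imono (leq_maxl _ _) _ In.
  exact: Imono (leq_maxr _ _) _ Ik.
have [s hs] := hR (submod_bundle hU).
have /choice[f hf] (i : 'I_(size s)) : exists n, I n s`_i.
  (* Each generator is a combination of the generators with Kronecker coefficients. *)
  apply/(mem_submod hU)/hs; exists (fun j => (j == i :> nat)%:R).
  rewrite (bigD1 i) //= eqxx mul1r big1 ?addr0 // => j ij.
  by move: ij; rewrite -val_eqE /= => /negPf->; rewrite mul0r.
exists (\max_i f i) => k nk; apply/seteqP; split; last exact: Imono.
move=> x Ikx; have [c ->] : exists c : nat -> R, x = \sum_(i < size s) c i * s`_i.
  by apply/hs/(mem_submod hU); exists k.
apply: (submod_sum (hI _)) => i _; apply: ideal_mull => //.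
by apply: Imono (hf i); apply: leq_bigmax.
Qed.

Lemma noetherian_max (F : set (set R)) I0 : F I0 ->
  (forall I, F I -> is_ideal I) ->
  exists I, F I /\ forall J, F J -> (I `<=` J)%classic -> J = I.
Proof.
move=> FI0 hF; apply: contrapT => noMax.
have step (I : {I | F I}) : {J : {J | F J} | (sval I `<` sval J)%classic}.
  apply: cid; case: I => I FI /=; apply: contrapT => noJ; apply: noMax.
  exists I; split=> // J FJ IJ; apply: contrapT => /eqP JI; apply: noJ.
  exists (exist _ J FJ); rewrite properEneq; split=> //; rewrite eq_sym; exact/eqP/eqP.
have [f [_ hf]] := dependent_choice step (exist _ I0 FI0).
have hI n : is_ideal (sval (f n)) by apply: hF; exact: svalP.
have [n hn] := noetherian_acc hI (fun n => properW (hf n)).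
by case: (hf n); rewrite hn //.
Qed.

End Noetherian.

(** * Associated primes of an ideal and their finiteness *)

Section AssociatedPrimes.
Context {R : comNzRingType}.
Implicit Types (I J P Q : set R) (a b x y : R).

Definition assoc I : set (set R) :=
  [set P | is_prime P /\ exists x, P = colon I x].

Lemma colonM I x y : colon (colon I x) y = colon I (x * y).
Proof. by apply/seteqP; split=> r; rewrite /colon /= -mulrA [y * x]mulrC. Qed.

Lemma prime_colonM I P x s : is_prime P -> P = colon I x -> is_ideal I ->
  ~ P s -> P = colon I (s * x).
Proof.
move=> [hP P1 Pm] Px hI Ps; apply/seteqP; split=> r.
  by rewrite Px /colon /= mulrCA => ?; apply: ideal_mull.
have -> : colon I (s * x) r = P (r * s) by rewrite Px /colon /= mulrA.
by move=> /Pm[].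
Qed.

(** Let P = (I : x). If some s x lies in I + (a) but not in I, then s x = b a modulo I and P = (I :
    s x) = ((I : a) : b). Otherwise the multiples of x in I + (a) are already in I, so P = (I + (a)
    : x). *)
Lemma assoc_sub I a : is_ideal I ->
  (assoc I `<=` assoc (colon I a) `|` assoc (ideal_add I a))%classic.
Proof.
move=> hI P [hP [x Px]].
have [[s [[b Ib] Is]]|hs] := pselect (exists s, ideal_add I a (s * x) /\ ~ I (s * x)).
  left; split=> //; exists b; rewrite colonM.
  have Ps : ~ P s by rewrite Px.
  have Ir r : I (r * (s * x) - r * (a * b)).
    by rewrite -mulrBr [a * b]mulrC; apply: ideal_mull.
  rewrite (prime_colonM hP Px hI Ps); apply/seteqP; split=> r; rewrite /colon /=.
    by move=> Irs; rewrite -[r * (a * b)](subKr (r * (s * x))); apply: (submodB hI).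
  exact: (submod_subr hI (Ir r)).
right; split=> //; exists x; rewrite Px; apply/seteqP; split=> r Ir.
  exact: (@sub_ideal_add _ I a (r * x) Ir).
by apply: contrapT => nIr; apply: hs; exists r.
Qed.

Lemma assoc_prime I : is_prime I -> (assoc I `<=` [set I])%classic.
Proof.
move=> [hI I1 Im] P [[hP P1 Pm] [x Px]]; rewrite Px /=.
have Ix : ~ I x by move=> Ix; apply: P1; rewrite Px /colon /= mul1r.
apply/seteqP; split=> [r /Im[] //|r]; exact: ideal_mulr.
Qed.

Lemma sub_ideal_add_neq I a : is_ideal I -> ~ I a -> ideal_add I a <> I.
Proof. by move=> hI Ia eI; apply: Ia; rewrite -eI; exact: mem_ideal_add. Qed.

Hypothesis hR : noetherian R.

(** Noetherian induction: a maximal counterexample J is proper and not prime, so it contains a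
    product a b with a and b outside J. Then (J : a) and J + (a) are strictly larger, and
    [assoc_sub] bounds the associated primes of J. *)
Lemma finite_assoc I : is_ideal I -> finite_set (assoc I).
Proof.
move=> hI0; apply: contrapT => nfin.
have [||J [[hJ nJ] Jmax]] := @noetherian_max _ hR
  [set I | is_ideal I /\ ~ finite_set (assoc I)] I => //; first by move=> ? [].
have grow K : is_ideal K -> (J `<=` K)%classic -> K <> J -> finite_set (assoc K).
  move=> hK JK KJ; apply: contrapT => nK; apply: KJ; exact: Jmax.
have [J1|J1] := pselect (J 1).
  apply: nJ; suff -> : assoc J = set0 by exact: finite_set0.
  apply/seteqP; split=> // P [[_ P1 _] [x Px]]; apply: P1.
  by rewrite Px /colon /= mul1r -[x]mulr1; apply: ideal_mull.
have [Jp|Jp] := pselect (is_prime J).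
  exact: nJ (sub_finite_set (assoc_prime Jp) (finite_set1 _)).
have [a [b [Jab Ja Jb]]] : exists a b, [/\ J (a * b), ~ J a & ~ J b].
  apply: contrapT => H; apply: Jp; split=> // a b Jab.
  by apply: contrapT => /not_orP[Ja Jb]; apply: H; exists a, b.
apply: nJ; apply: sub_finite_set (assoc_sub a hJ) _; rewrite finite_setU; split.
  apply: grow; [exact: colon_ideal|exact: sub_colon|] => eJ.
  by apply: Jb; rewrite -eJ /colon /= mulrC.
apply: grow; [exact: ideal_add_ideal|exact: sub_ideal_add|].
exact: sub_ideal_add_neq.
Qed.

(** If b x is not in I, then (I : b x) contains (I : x), hence equals it by maximality, so a b x in
    I forces a x in I. *)
Lemma colon_prime I x : is_ideal I -> ~ I x ->
  (forall s, ~ I (s * x) -> (colon I x `<=` colon I (s * x))%classic ->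
     colon I (s * x) = colon I x) ->
  is_prime (colon I x).
Proof.
move=> hI Ix hmax; split; first exact: colon_ideal; first by rewrite /colon /= mul1r.
move=> a b Iab; have [Ib|Ib] := pselect (I (b * x)); [by right|left].
rewrite -(hmax b) //; first by rewrite /colon /= mulrA.
by move=> r Ir; rewrite /colon /= mulrCA; apply: ideal_mull.
Qed.

Lemma assoc_exists I : is_ideal I -> ~ I 1 ->
  exists x, ~ I x /\ is_prime (colon I x).
Proof.
move=> hI I1; have [||_ [[x Ix <-] Jmax]] := @noetherian_max _ hR
  [set colon I x | x in ~` I]%classic (colon I 1).
- by exists 1.
- by move=> _ [x _ <-]; exact: colon_ideal.
exists x; split=> //; apply: colon_prime => // s Is sub; apply: Jmax => //.
by exists (s * x).
Qed.

End AssociatedPrimes.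

(** * Local rings *)

Definition is_local {R : comNzRingType} (m : set R) : Prop :=
  [/\ is_ideal m, ~ m 1 & forall I : set R, is_ideal I -> ~ I 1 -> (I `<=` m)%classic].

Section Local.
Context {R : comNzRingType}.
Implicit Types (I J P Q : set R) (a b x y : R).

Lemma zero_ideal : is_ideal ([set 0] : set R).
Proof. by split=> // a x y /= -> ->; rewrite scaler0 addr0. Qed.

(** A proper ideal lies in one that is maximal among the proper ideals above it; this is a maximal
    ideal of the ring, so it is m by uniqueness. *)
Lemma noetherian_local (m : idealr R) :
  noetherian R -> local_ring m -> is_local [set x | x \in m].
Proof.
move=> hR [[/idealr_closedP[hm m1] mmax] muniq]; split=> //; first exact/negP.
move=> I hI I1.
have [|K []|J [[hJ J1 IJ] Jmax]] := @noetherian_max _ hR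
  [set J | [/\ is_ideal J, ~ J 1 & (I `<=` J)%classic]] I => //; first by split.
pose p : {pred R} := [pred x | `[< J x >]].
have pE : [set x | x \in p]%classic = J by apply/seteqP; split=> x /= /asboolP.
have hp : maximal_ideal p.
  split; first by apply/idealr_closedP; rewrite pE; split=> //; apply/asboolP.
  move=> q /idealr_closedP[hq q1] pq.
  have qJ : [set x | x \in q]%classic = J.
    apply: Jmax; first split=> //; first exact/negP.
      by move=> x /IJ Jx; apply: pq; apply/asboolP.
    by move=> x Jx; apply: pq; apply/asboolP.
  move=> x; apply/idP/idP=> [xq|]; last exact: pq.
  by apply/asboolP; rewrite -qJ.
by move=> x /IJ Jx; rewrite /= -(muniq _ hp); apply/asboolP.
Qed.

Variable m : set R.
Hypothesis hm : is_local m.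

Lemma local_inv x : ~ m x -> exists y, y * x = 1.
Proof.
case: hm => hmi m1 mmax mx; apply: contrapT => H; apply: mx.
apply: (mmax (ideal_add [set 0] x)).
- exact: ideal_add_ideal zero_ideal.
- by move=> [y] /subr0_eq e; apply: H; exists y.
- exact: mem_ideal_add zero_ideal.
Qed.

Lemma prime_sub_local P : is_prime P -> (P `<=` m)%classic.
Proof. by case: hm => _ _ mmax [hP P1 _]; apply: mmax. Qed.

Lemma local_unit_sub x : m x -> exists y, y * (1 - x) = 1.
Proof.
move=> mx; apply: local_inv => mx'; case: hm => hmi m1 _; apply: m1.
by rewrite -(subrK x 1); apply: (submodD hmi).
Qed.

End Local.

(** * Krull's principal ideal theorem and the primes just below m *)

Section KrullPrincipalIdeal.
Context {R : comNzRingType} (m : set R).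
Hypotheses (hR : noetherian R) (hm : is_local m).
Implicit Types (I J P Q : set R) (a b x y : R).

(** Choosing K maximal among the ideals between J and I other than I reduces to one generator: I = K
    + (y) for every y in I outside K. Writing y = a x modulo J and a = b y modulo K puts (1 - b x) y
    in K, and 1 - b x is a unit. *)
Lemma nakayama I J x : is_ideal I -> is_ideal J -> (J `<=` I)%classic -> m x ->
  (forall r, I r -> exists2 a, I a & J (r - a * x)) -> (I `<=` J)%classic.
Proof.
move=> hI hJ JI mx hx; apply: contrapT => nIJ.
have [||K [[hK JK KI nIK] Kmax]] := @noetherian_max _ hR [set K |
  [/\ is_ideal K, J `<=` K, K `<=` I & ~ (I `<=` K)]]%classic J.
- by split.
- by move=> K [].
apply: nIK => y Iy; apply: contrapT => Ky.
have IKy : (I `<=` ideal_add K y)%classic.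
  apply: contrapT => nIKy; apply: (sub_ideal_add_neq hK Ky).
  apply: Kmax; last exact: sub_ideal_add; split=> //; first exact: ideal_add_ideal.
    by move=> r /JK; exact: sub_ideal_add.
  move=> r [a /KI Ira]; apply: (submod_subr hI Ira); exact: ideal_mull.
have [a /IKy[b Kb] /JK Ka] := hx y Iy.
have [c cu] : exists c, c * (1 - b * x) = 1.
  by apply: (local_unit_sub hm); apply: ideal_mull => //; case: hm.
apply: Ky; have -> : y = c * ((y - a * x) + x * (a - b * y)).
  rewrite mulrBr addrA [x * a]mulrC subrK mulrA [x * b]mulrC.
  by rewrite -{2}[y]mul1r -mulrBl mulrA cu mul1r.
by apply: ideal_mull => //; apply: (submodD hK) => //; apply: ideal_mull.
Qed.

(** Says that R/I is Artinian. *)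
Definition dcc_above I : Prop :=
  forall D : nat -> set R, (forall n, is_ideal (D n)) ->
  (forall n, I `<=` D n)%classic -> (forall n, D n.+1 `<=` D n)%classic ->
  exists n, forall k, (n <= k)%N -> D k = D n.

(** In a maximal counterexample J, some a outside J has (J : a) prime, hence equal to m, so (J +
    (a))/J is simple. A descending chain above J becomes stable after adding a; it remains to
    compare its intersections with J + (a). *)
Lemma dcc_above_primary I : is_ideal I ->
  (forall P, is_prime P -> (I `<=` P)%classic -> P = m) -> dcc_above I.
Proof.
move=> hI0 I0m; apply: contrapT => nI0.
have [||J [[hJ Jm nJ] Jmax]] := @noetherian_max _ hR [set I | [/\ is_ideal I,
    forall P, is_prime P -> (I `<=` P)%classic -> P = m & ~ dcc_above I]] I.
- by split.
- by move=> ? [].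
apply: nJ => D hD JD Ddec.
have Dmono n k : (n <= k)%N -> (D k `<=` D n)%classic.
  move/subnK=> <-; elim: (k - n)%N => // j IHj x; rewrite addSn => /Ddec; exact: IHj.
have [J1|J1] := pselect (J 1).
  exists 0%N => k _; apply/seteqP; split=> x _; rewrite -[x]mulr1;
    by apply: ideal_mull => //; apply: JD.
have [a [Ja Jap]] := assoc_exists hR hJ J1.
have Jam := Jm _ Jap (sub_colon _ hJ).
have ha : dcc_above (ideal_add J a).
  apply: contrapT => nJa; apply: (sub_ideal_add_neq hJ Ja).
  apply: Jmax; last exact: sub_ideal_add; split=> //; first exact: ideal_add_ideal.
  by move=> P hP JP; apply: Jm => // x Jx; apply/JP/sub_ideal_add.
have [N1 hN1] : exists n, forall k, (n <= k)%N ->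
    ideal_add (D k) a = ideal_add (D n) a.
  apply: (ha (fun n => ideal_add (D n) a)) => n; first exact: ideal_add_ideal.
    by move=> x [b /JD Db]; exists b.
  by move=> x [b /Ddec Db]; exists b.
(* Either a lies in every term, and adding it changes nothing, or a has left the chain from [N2]
   on. *)
have [aD|] := pselect (forall n, D n a).
  exists N1 => k /hN1 e; suff DE n : ideal_add (D n) a = D n by rewrite -[LHS]DE e DE.
  apply/seteqP; split=> [x [b Db]|]; last exact: sub_ideal_add.
  by apply: (submod_subr (hD n) Db); apply: ideal_mull.
move=> /existsNP[N2 aN2]; exists (maxn N1 N2) => k hk.
apply/seteqP; split; first exact: Dmono.
have [N1k N2k] : (N1 <= k)%N /\ (N2 <= k)%N by apply/andP; rewrite -geq_max.
move=> x Dx; have : ideal_add (D (maxn N1 N2)) a x by exact: sub_ideal_add.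
rewrite hN1 ?leq_maxl // -(hN1 k) // => -[b Db].
have Dba : D (maxn N1 N2) (b * a).
  rewrite -[b * a](subKr x); apply: (submodB (hD _)) => //; exact: Dmono Db.
(* If b were a unit, a would lie in [D N2]; so b is in m = (J : a), and b a lies in J, hence in
   [D k]. *)
have [mb|/(local_inv hm)[c cb]] := pselect (m b); last first.
  case: aN2; rewrite -[a]mul1r -cb -mulrA; apply: (ideal_mull _ (hD _)).
  exact: Dmono (leq_maxr _ _) _ Dba.
apply: (submod_subr (hD k) Db); apply: JD; by rewrite -Jam in mb.
Qed.

(** If m were the only prime containing x, then R/(x) would be Artinian. The symbolic powers, modulo
    p and with respect to q, of an element z of q outside p would then become stable, which puts z^n
    in p + (z^(n+1)) locally at q and contradicts z in q. *)
Lemma krull_principal_ideal (p q : set R) x :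
  is_prime p -> is_prime q -> (p `<=` q)%classic -> p <> q -> q <> m -> m x ->
  exists P, [/\ is_prime P, P <> m & P x].
Proof.
move=> hp hq pq npq qm mx; apply: contrapT => noP.
have xm P : is_prime P -> P x -> P = m.
  by move=> hP Px; apply: contrapT => nPm; apply: noP; exists P.
have qx : ~ q x by move=> /(xm _ hq).
have [z qz pz] : exists2 z, q z & ~ p z.
  apply: contrapT => noz; apply: npq; apply/seteqP; split=> // z qz.
  by apply: contrapT => pz; apply: noz; exists z.
case: (hp) => hpi p1 pM; case: (hq) => hqi q1 qM.
have qMn a b : ~ q a -> ~ q b -> ~ q (a * b) by move=> qa qb /qM[].
(* The contraction to R of p + (z^n) extended to the localization at q. *)
pose D n : set R := [set r | exists s, ~ q s /\ exists a, p (s * r - a * z ^+ n)]%classic.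
have hD n : is_ideal (D n).
  split=> [|c u v [s [qs [a pa]]] [t [qt [b pb]]]].
    by exists 1; split=> //; exists 0; rewrite mulr0 mul0r subr0; exact: submod0 hpi.
  exists (s * t); split; first exact: qMn.
  exists (c * t * a + s * b).
  have -> : s * t * (c *: (u : R^o) + v) - (c * t * a + s * b) * z ^+ n =
    c * t * (s * u - a * z ^+ n) + s * (t * v - b * z ^+ n).
    rewrite [_ *: _]/(c * u) !mulrBr mulrDr mulrDl opprD addrACA !mulrA.
    by rewrite [s * t * c]mulrC [s * t]mulrC mulrA.
  by apply: (submodD hpi); apply: ideal_mull.
have Ddec n : (D n.+1 `<=` D n)%classic.
  move=> r [s [qs [a pa]]]; exists s; split=> //; exists (a * z).
  by rewrite -mulrA -exprS.
have [n hn] : exists n, forall k, (n <= k)%N ->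
    ideal_add (D k) x = ideal_add (D n) x.
  apply: (@dcc_above_primary (ideal_add [set 0] x) _ _ (fun n => ideal_add (D n) x)).
  - exact: ideal_add_ideal zero_ideal.
  - by move=> P hP xP; apply: xm => //; apply: xP; exact: mem_ideal_add zero_ideal.
  - by move=> n; apply: ideal_add_ideal.
  - move=> k r [a /= e]; exists a; rewrite e; exact: submod0 (hD _).
  - by move=> k r [a /Ddec]; exists a.
(* If r - a x is in [D n.+1] with r in [D n], then a x is in [D n], and so is a because x is outside
   q; now Nakayama applies. *)
have DD : (D n `<=` D n.+1)%classic.
  apply: (nakayama (hD n) (hD _) (Ddec n) mx) => r Dr.
  have : ideal_add (D n) x r by exact: sub_ideal_add.
  rewrite -(hn n.+1) // => -[a Da]; exists a => //.
  have : D n (a * x).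
    by rewrite -[a * x](subKr r); apply: (submodB (hD n)) => //; exact: Ddec.
  move=> [s [qs [b pb]]]; exists (s * x); split; first exact: qMn.
  by exists b; rewrite -mulrA [x * a]mulrC.
have [s [qs [a pa]]] : D n.+1 (z ^+ n).
  by apply: DD; exists 1; split=> //; exists 1; rewrite subrr; exact: submod0 hpi.
apply: qs; apply: (@submod_subr _ R^o _ hqi s (a * z)); last exact: ideal_mull.
apply: pq; have /pM[//|] : p ((s - a * z) * z ^+ n).
  by rewrite mulrBl -mulrA -exprS.
by move/(is_primeX hp).
Qed.

(** The closed points of the punctured spectrum. *)
Definition coheight_one P :=
  [/\ is_prime P, P <> m & forall Q, is_prime Q -> Q <> m -> (P `<=` Q)%classic -> Q = P].

Lemma coheight_one_above P : is_prime P -> P <> m ->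
  exists2 Q, coheight_one Q & (P `<=` Q)%classic.
Proof.
move=> hP Pm; have [||Q [[hQ Qm PQ] Qmax]] := @noetherian_max _ hR
  [set Q | [/\ is_prime Q, Q <> m & P `<=` Q]]%classic P.
- by split.
- by move=> Q [[]].
exists Q => //; split=> // Q' hQ' Q'm QQ'; apply: Qmax => //.
by split=> // r /PQ/QQ'.
Qed.

Lemma prime_nonmember P : is_prime P -> P <> m -> exists2 c, m c & ~ P c.
Proof.
move=> hP Pm; apply: contrapT => noc; apply: Pm.
apply/seteqP; split; first exact: (prime_sub_local hm).
by move=> c mc; apply: contrapT => Pc; apply: noc; exists c.
Qed.

(** Induction on the list: if the x that avoids [s] falls in the new prime P, add to it an element y
    of m that lies in every member of [s] but not in P. *)
Lemma coheight_one_avoid (s : seq (set R)) : (forall P, P \in s -> coheight_one P) ->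
  exists2 x, m x & forall P, P \in s -> ~ P x.
Proof.
have hmi : is_ideal m by case: hm.
elim: s => [|P s IHs] hs; first by exists 0 => //; exact: submod0 hmi.
have [x mx sx] : exists2 x, m x & forall P, P \in s -> ~ P x.
  by apply: IHs => Q Qs; apply: hs; rewrite inE Qs orbT.
have [Ps|Ps] := boolP (P \in s).
  by exists x => // Q; rewrite inE => /predU1P[->|]; exact: sx.
have [Px|nPx] := pselect (P x); last first.
  by exists x => // Q; rewrite inE => /predU1P[->//|]; exact: sx.
have hP : coheight_one P by apply: hs; rewrite mem_head.
have [[hPi P1 PM] Pm _] := hP.
(* The element y is a product of factors z in Q and outside P, one for each Q in [s]; they exist
   because distinct primes of this kind are incomparable. *)
have [y my [Py sy]] : exists2 y, m y & ~ P y /\ forall Q, Q \in s -> Q y.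
  have : forall Q, Q \in s -> coheight_one Q.
    by move=> Q Qs; apply: hs; rewrite inE Qs orbT.
  elim: s Ps {IHs hs sx} => [_ _|Q s IHs].
    by have [c] := prime_nonmember (And3 hPi P1 PM) Pm; exists c.
  rewrite inE negb_or => /andP[PQ Ps] hs.
  have [y my [Py sy]] : exists2 y, m y & ~ P y /\ forall Q, Q \in s -> Q y.
    by apply: IHs => // Q' Qs; apply: hs; rewrite inE Qs orbT.
  have [hQ Qm Qmax] : coheight_one Q by apply: hs; rewrite mem_head.
  have [z Qz Pz] : exists2 z, Q z & ~ P z.
    apply: contrapT => noz; case/eqP: PQ; apply: Qmax => // z Qz.
    by apply: contrapT => Pz; apply: noz; exists z.
  exists (z * y); first exact: ideal_mull.
  split=> [/PM[]//|Q']; rewrite inE => /predU1P[->|Q's].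
    by apply: ideal_mulr => //; case: hQ.
  have [[hQ' _ _] _ _] : coheight_one Q' by apply: hs; rewrite inE Q's orbT.
  by apply: ideal_mull => //; exact: sy.
exists (x + y); first exact: (submodD hmi).
move=> Q; rewrite inE => /predU1P[->|Qs] Qxy.
  by apply: Py; rewrite -[y](addKr x) addrC; exact: (submodB (M := R^o) hPi).
apply: (sx _ Qs); have [[hQ _ _] _ _] : coheight_one Q by apply: hs; rewrite inE Qs orbT.
by rewrite -[x](addrK y); apply: (submodB (M := R^o) hQ) => //; exact: sy.
Qed.

(** Were they finitely many, some x in m would avoid them all; but x lies in a prime other than m,
    and that prime lies below one of them. *)
Lemma infinite_coheight_one (p q : set R) :
  is_prime p -> is_prime q -> (p `<=` q)%classic -> p <> q -> q <> m ->
  infinite_set [set P | coheight_one P]%classic.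
Proof.
move=> hp hq pq npq qm /finite_seqP[s sE].
have hs P : P \in s <-> coheight_one P.
  by change ([set` s]%classic P <-> coheight_one P); rewrite -sE.
have [|x mx sx] := @coheight_one_avoid s; first by move=> P /hs.
have [P [hP Pm Px]] := krull_principal_ideal hp hq pq npq qm mx.
have [Q /hs Qs PQ] := coheight_one_above hP Pm.
exact: sx Qs (PQ _ Px).
Qed.

End KrullPrincipalIdeal.

(** * Linear maps out of a quotient module *)

Section QuotientLift.
Context {R : comNzRingType} {M V : lmodType R} (N : submodClosed M) (g : M -> V).
Hypotheses (gL : linear g) (gN : forall x, x \in N -> g x = 0).

Definition quot_lift of linear g & (forall x, x \in N -> g x = 0) :
  quot_module N -> V := fun x => g (repr x).

Local Notation h := (quot_lift gL gN).

Lemma quot_lift_pi x : h (\pi_(quot_module N) x) = g x.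
Proof.
apply/eqP; rewrite -subr_eq0 -[g x]scale1r -scaleN1r addrC scalerA mulr1 -gL gN //.
rewrite scaleN1r addrC; apply/quot_piP; exact: reprK.
Qed.

Lemma quot_lift_linear : linear h.
Proof.
move=> a x y; have [[u ->] [v ->]] := (quot_pi_surj x, quot_pi_surj y).
by rewrite quot_piZ -quot_piD !quot_lift_pi gL.
Qed.

HB.instance Definition _ :=
  GRing.isLinear.Build R (quot_module N) V *:%R h quot_lift_linear.

End QuotientLift.

(** * The injective envelope of the residue field *)

Section Envelope.
Context {R : comNzRingType} (m : idealr R) {E : lmodType R}.
Variable iota : {linear residue_module m -> E}.
Hypotheses (hR : noetherian R) (hlocal : local_ring m).
Hypothesis hE : injective_envelope iota.
Implicit Types (I : set R) (a c r : R) (e x : E).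

Local Notation mm := [set x | x \in m]%classic.

(** Multiplication by r embeds R/(I : r) into R/I, and R/(I : r) maps onto k, hence to E, since (I :
    r) lies in m. By injectivity this map extends to R/I; take for e the image of 1, so that r e is
    the image of 1 under k -> E. *)
Lemma envelope_cogenerator I r : is_ideal I -> ~ I r ->
  exists e : E, (forall a, I a -> a *: e = 0) /\ r *: e <> 0.
Proof.
move=> hI Ir; have [hm _ mmax] := noetherian_local hR hlocal.
pose A := submod_bundle (colon_ideal r hI); pose B := submod_bundle hI.
pose K := (ideal_submod m : submodClosed R^o).
have fL : linear (fun a : R^o => \pi_(quot_module B) (r *: a : R^o)).
  by move=> a u v; rewrite quot_piZ -quot_piD scalerDr !scalerA mulrC.
have f0 (a : R^o) : a \in A -> \pi_(quot_module B) (r *: a : R^o) = 0.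
  move=> /mem_submod Ia; apply/eqP; rewrite quot_pi_eq0; apply/mem_submod.
  by rewrite [_ *: _]mulrC.
have gL : linear (fun a : R^o => iota (\pi_(quot_module K) a)).
  by move=> a u v; rewrite quot_piD -quot_piZ linearP.
have g0 (a : R^o) : a \in A -> iota (\pi_(quot_module K) a) = 0.
  move=> /mem_submod Ia; apply/eqP; rewrite raddf_eq0; last by case: hE => _ [].
  rewrite quot_pi_eq0; apply: (mmax _ (colon_ideal r hI)) => //.
  by rewrite /colon /= mul1r.
have finj : injective (quot_lift fL f0).
  apply: raddf_inj => x; have [u ->] := quot_pi_surj x; rewrite /= quot_lift_pi.
  move/eqP; rewrite quot_pi_eq0 => /mem_submod Iu; apply/eqP.
  by rewrite quot_pi_eq0; apply/mem_submod; rewrite /colon /= mulrC.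
have [h hfg] := hE.1 _ _ _ (quot_lift gL g0) finj.
exists (h (\pi_(quot_module B) (1 : R^o))).
have hZ a : a *: h (\pi_(quot_module B) (1 : R^o)) =
            h (\pi_(quot_module B) (a *: (1 : R^o))) by rewrite -linearZ quot_piZ.
split=> [a Ia|].
  rewrite hZ; apply/eqP; rewrite -(raddf0 h); apply/eqP; congr (h _).
  by apply/eqP; rewrite quot_pi_eq0; apply/mem_submod; rewrite [_ *: _]mulr1.
rewrite hZ; have := hfg (\pi_(quot_module A) (1 : R^o)).
rewrite /= !quot_lift_pi => ->; apply/eqP; rewrite raddf_eq0; last by case: hE => _ [].
by rewrite quot_pi_eq0; have [_ /negP] := noetherian_local hR hlocal.
Qed.

(** The annihilators of the c^n e become stable. If c^n e is nonzero at that stage, essentiality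
    gives a nonzero multiple a c^n e in the image of k; c kills it, so a kills c^(n+1) e but not c^n
    e. *)
Lemma envelope_torsion c e : c \in m -> exists k, c ^+ k *: e = 0.
Proof.
move=> mc; pose I n : set R := [set a | a *: (c ^+ n *: e) = 0]%classic.
have hI n : is_ideal (I n).
  split=> [|a u v]; rewrite /I /= ?scale0r // => Iu Iv.
  by rewrite scalerDl -scalerA Iu Iv scaler0 addr0.
have Isub n : (I n `<=` I n.+1)%classic.
  by move=> a Ia; rewrite /I /= exprS -scalerA scalerA mulrC -scalerA [a *: _]Ia scaler0.
have [n hn] := noetherian_acc hR hI Isub; exists n; apply: contrapT => ne0.
pose N := [set x | exists a, x = a *: (c ^+ n *: e)]%classic.
have hN : is_submod N.
  split=> [|a _ _ [u ->] [v ->]]; first by exists 0; rewrite scale0r.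
  by exists (a * u + v); rewrite scalerDl -(scalerA a u).
have [|z /mem_submod[a za] z0] := hE.2.2 (submod_bundle hN).
  by exists (c ^+ n *: e); [apply/mem_submod; exists 1; rewrite scale1r|exact/eqP].
case/eqP: z0; rewrite za; suff : I n.+1 a by rewrite hn.
rewrite /I /= exprS -scalerA scalerA mulrC -scalerA -za -linearZ.
have [u ->] := quot_pi_surj z; rewrite quot_piZ.
have /eqP -> : \pi_(residue_module m) (c *: (u : R^o)) == 0.
  have [hm _ _] := noetherian_local hR hlocal.
  by rewrite quot_pi_eq0; exact: (ideal_mulr u hm mc).
exact: raddf0.
Qed.

End Envelope.

(** * Associated primes avoiding an element, and a criterion for failure *)

Lemma assoc_avoid (R : comNzRingType) (I : set R) c : noetherian R -> is_ideal I ->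
  (forall k, ~ I (c ^+ k)) -> exists r, is_prime (colon I r) /\ ~ colon I r c.
Proof.
(* Maximality is taken among the x with no c^k x in I, which amounts to finding an associated prime
   after inverting c. *)
move=> hR hI Ic; have [||_ [[x Ix <-] Jmax]] := @noetherian_max _ hR
  [set colon I x | x in [set x | forall k, ~ I (c ^+ k * x)]]%classic (colon I 1).
- by exists 1 => // k; rewrite mulr1.
- by move=> _ [x _ <-]; exact: colon_ideal.
exists x; split; last by have := Ix 1; rewrite expr1.
apply: colon_prime => // [|s Is sub].
  by have := Ix 0; rewrite expr0 mul1r.
(* By maximality x and c^k x have the same colon ideal, so c^k s x in I would give s x in I; thus s
   x belongs to the family. *)
apply: (Jmax) => //; exists (s * x) => // k Iks; apply: Is.
have : colon I (c ^+ k * x) s by rewrite /colon /= mulrCA.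
rewrite (Jmax (colon I (c ^+ k * x))) //.
  by exists (c ^+ k * x) => // j; rewrite mulrA -exprD.
by move=> r; rewrite /colon /= mulrCA; apply: ideal_mull.
Qed.

Lemma not_weakly_laskerian (A : comNzRingType) (N : set A) (y : nat -> A) :
  is_ideal N -> (forall n, is_prime (colon N (y n))) ->
  injective (fun n => colon N (y n)) -> ~ weakly_laskerian_ring A.
Proof.
move=> hN hP Pinj /(_ (submod_bundle hN)) hfin.
pose p n : pred A := [pred r | `[< colon N (y n) r >]].
have pE n : [set x | x \in p n]%classic = colon N (y n).
  by apply/seteqP; split=> x /= /asboolP.
have pinj : injective p by move=> i j pij; apply: Pinj; rewrite -!pE pij.
apply: infinite_nat; apply: sub_finite_set (finite_preimage (f := p) _ hfin).
  move=> n _; apply/AssP; split; first by rewrite pE.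
  exists (y n) => r.
  by split=> /asboolP ry; apply/asboolP.
by move=> i j _ _; exact: pinj.
Qed.

(** * Monic polynomials and torsion in polynomial rings *)

Section PolynomialObstruction.
Context {A : comNzRingType}.
Implicit Types (I : set A) (f g h : {poly A}).

Definition poly_in I : set {poly A} := [set g | forall i, I g`_i].

Lemma poly_in_ideal I : is_ideal I -> is_ideal (poly_in I).
Proof.
move=> hI; split=> [i|a u v Iu Iv i]; first by rewrite coef0; exact: submod0 hI.
rewrite coefD coefM; apply: (submodD (M := A^o) hI) => //.
by apply: (submod_sum hI) => j _; apply: ideal_mull.
Qed.

Lemma poly_inC I a : is_ideal I -> I a -> poly_in I a%:P.
Proof. by move=> hI Ia i; rewrite coefC; case: eqP => // _; exact: submod0 hI. Qed.

Lemma sub_poly_in I J : (I `<=` J)%classic -> (poly_in I `<=` poly_in J)%classic.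
Proof. by move=> IJ g Ig i; exact/IJ/Ig. Qed.

(** Descending induction on the index: with d the degree of f, the coefficient of f g at j + d is
    that of g at j plus multiples of higher coefficients of g. Only degrees at least d are tested,
    so low coefficients of f g may be ignored. *)
Lemma poly_in_monicM I f g : is_ideal I -> f \is monic ->
  (forall i, ((size f).-1 <= i)%N -> I (f * g)`_i) -> poly_in I g.
Proof.
move=> hI f1 hfg j; have [k] := ubnP (size g - j); elim: k j => // k IHk j.
rewrite ltnS => gj; have [gsj|jg] := leqP (size g) j.
  by rewrite nth_default //; exact: submod0 hI.
set d := (size f).-1 in hfg; have := hfg (j + d)%N (leq_addl _ _).
have dj : (d < (j + d).+1)%N by rewrite ltnS leq_addl.
rewrite coefM (bigD1 (Ordinal dj)) //= addnK -/(lead_coef f) (monicP f1) mul1r.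
rewrite -[X in _ + X]opprK => Ifg; apply: (submod_subr (M := A^o) hI Ifg).
apply: (submodN (M := A^o) hI); apply: (submod_sum hI) => i; rewrite -val_eqE /= => id.
have [di|id'] := ltnP d i.
  rewrite [f`_i]nth_default ?mul0r; first exact: submod0 hI.
  by rewrite (leq_trans (leqSpred _)).
apply: ideal_mull => //; apply: IHk; apply: leq_trans gj.
have {id id'}id : (i < d)%N by rewrite ltn_neqAle id.
apply: ltn_sub2l => //; rewrite -addnBA ?(ltnW id) // -[X in (X < _)%N]addn0 ltn_add2l.
by rewrite subn_gt0.
Qed.

Variables (M : set A).
Hypotheses (hM : is_ideal M) (Minv : forall a, ~ M a -> exists b, M (1 - b * a)).

(** Rescale the highest coefficient outside M to 1 and drop the terms above it, which lie in M. This
    turns a remainder not in M[X] into a monic polynomial that is no longer. *)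
Lemma monic_mod (r : {poly A}) i : ~ M r`_i ->
  exists u g, [/\ g \is monic, (size g <= size r)%N & poly_in M (g - u%:P * r)].
Proof.
move=> ri; pose Q j := `[< ~ M r`_j >].
have Qi : exists j, Q j by exists i; apply/asboolP.
have Qle j : Q j -> (j <= size r)%N.
  move=> /asboolP rj; rewrite leqNgt; apply/negP => /ltnW jr; apply: rj.
  by rewrite nth_default //; exact: submod0 hM.
case: (ex_maxnP Qi Qle) => j /asboolP rj jmax.
have jr : (j < size r)%N.
  rewrite ltnNge; apply/negP => rsj; apply: rj.
  by rewrite nth_default //; exact: submod0 hM.
have [u Mu] := Minv rj; pose g := \poly_(k < j.+1) (if k == j then 1 else u * r`_k).
have gs : size g = j.+1 by rewrite size_poly_eq ?eqxx ?oner_eq0.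
exists u, g; split; rewrite ?gs //.
  by rewrite monicE lead_coefE gs coef_poly ltnSn eqxx.
move=> k; rewrite coefB coefCM coef_poly ltnS; case: (ltngtP k j) => kj.
- by rewrite subrr; exact: submod0 hM.
- rewrite sub0r; apply: (submodN (M := A^o) hM); apply: ideal_mull => //.
  by apply: contrapT => rk; have := jmax k; rewrite leqNgt kj => /(_ (asboolT rk)).
- by rewrite kj.
Qed.

Variable N : set {poly A}.
Hypothesis hN : is_ideal N.

Lemma poly_in_kill g y : (forall a, M a -> N (a%:P * y)) -> poly_in M g -> N (g * y).
Proof.
move=> My Mg; rewrite -[g]coefK poly_def mulr_suml; apply: (submod_sum hN) => i _.
by rewrite -mul_polyC [_ * 'X^i]mulrC -mulrA; apply: ideal_mull => //; exact/My/Mg.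
Qed.

(* A multiple of [y] killed by a monic polynomial of least possible degree has
   prime annihilator, as is seen by dividing by that polynomial. *)
Lemma assoc_monic_torsion f y : ~ N y -> (forall a, M a -> N (a%:P * y)) ->
  f \is monic -> N (f * y) -> exists h, is_prime (colon N (h * y)).
Proof.
move=> Ny My f1 Nfy.
pose D n := exists h g, [/\ ~ N (h * y), g \is monic, size g = n & N (g * (h * y))].
have exD : exists n, `[< D n >].
  by exists (size f); apply/asboolP; exists 1, f; rewrite mul1r.
case: (ex_minnP exD) => n /asboolP[h [g [Nh g1 gs Ngh]]] nmin; exists h.
have Mh a x : M a -> N (a%:P * (x * y)).
  by move=> Ma; rewrite mulrCA; apply: ideal_mull => //; exact: My.
split; first exact: colon_ideal; first by rewrite /colon /= mul1r.
rewrite /colon /= => a b Nab; have [Nb|Nb] := pselect (N (b * (h * y))); [by right|left].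
have aE := Pdiv.RingMonic.rdivp_eq g1 a; set q := Pdiv.Ring.rdivp a g in aE.
set r := Pdiv.Ring.rmodp a g in aE.
have Nr : N (r * (b * (h * y))).
  have -> : r * (b * (h * y)) = a * b * (h * y) - q * b * (g * (h * y)).
    rewrite aE !mulrDl [q * b * _]mulrCA -!mulrA addrAC.
    by rewrite [g * (q * _)]mulrCA subrr add0r.
  by apply: (submodB hN) => //; apply: ideal_mull.
have Mr : poly_in M r.
  move=> i; apply: contrapT => /monic_mod[u [g' [g'1 g's Mg']]].
  have : (n <= size g')%N.
    apply: nmin; apply/asboolP; exists (b * h), g'; split=> //; first by rewrite -mulrA.
    apply: (submod_subr hN) (ideal_mull u%:P hN Nr).
    rewrite -!mulrA [u%:P * _]mulrA -mulrBl; apply: poly_in_kill => // c Mc.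
    by rewrite [b * _]mulrA; exact: Mh.
  rewrite leqNgt -gs (leq_ltn_trans g's) // Pdiv.Ring.ltn_rmodpN0 //.
  exact: monic_neq0.
rewrite aE mulrDl; apply: (submodD hN); first by rewrite -mulrA; apply: ideal_mull.
by apply: poly_in_kill => // c Mc; exact: Mh.
Qed.

End PolynomialObstruction.

(* Euclid's argument: the factors [1 + euclid_prod n * 'X] are monic and pairwise
   comaximal. *)
Fixpoint euclid_prod (A : comNzRingType) (n : nat) : {poly A} :=
  if n is n'.+1 then euclid_prod A n' * (1 + euclid_prod A n' * 'X) else 1.

(** * An ideal of the polynomial ring with infinitely many associated primes *)

Section PolynomialConstruction.
Context {A : comNzRingType}.
Implicit Types (f g h : {poly A}).
Local Notation F := (euclid_prod A).
Local Notation fac n := (1 + F n * 'X).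

Lemma euclid_factor_monic g : g \is monic ->
  (1 + g * 'X \is monic) /\ (1 < size (1 + g * 'X)%R)%N.
Proof.
move=> g1; have g0 := monic_neq0 g1; have sg : (0 < size g)%N by rewrite size_poly_gt0.
have s1 : (size (1 : {poly A})%R < size (g * 'X)%R)%N.
  by rewrite size_poly1  size_mulX.
split; last by rewrite addrC size_polyDl // size_mulX.
by rewrite monicE lead_coefDr //  lead_coefMX -monicE.
Qed.

Lemma euclid_prod_monic n : F n \is monic.
Proof.
elim: n => [|n IHn]; first exact: monic1.
by rewrite /= monicMl //; have [] := euclid_factor_monic IHn.
Qed.

Lemma euclid_factor_dvd i j : (i < j)%N -> exists h, F j = h * fac i.
Proof.
elim: j => // j IHj; rewrite ltnS leq_eqVlt => /predU1P[->|/IHj[h Fj]].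
  by exists (F j).
by exists (h * fac j); rewrite /= {1}Fj mulrAC.
Qed.

(** For i < j, the factor of index i divides [F j], so the two factors generate 1. *)
Lemma prime_euclid_factor (P : set {poly A}) i j :
  is_prime P -> P (fac i) -> P (fac j) -> i = j.
Proof.
move=> [hP P1 _]; wlog ij : i j / (i < j)%N => [H|] Pi Pj.
  by have [/H->|/H->|] := ltngtP i j.
case: P1; rewrite -[1](addrK (F j * 'X)); apply: (submodB hP) => //.
have [h ->] := euclid_factor_dvd ij.
by rewrite mulrAC; apply: ideal_mull.
Qed.

Variables (M : set A) (L : nat -> set A) (u : nat -> A).
Hypotheses (hM : is_ideal M) (Minv : forall a, ~ M a -> exists b, M (1 - b * a)).
Hypotheses (hL : forall n, is_ideal (L n)) (L0 : L 0%N = [set 0]%classic).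
Hypotheses (Lmono : forall n, (L n `<=` L n.+1)%classic).
Hypotheses (Lu : forall n, L n.+1 (u n)) (nLu : forall n, ~ L n (u n)).
Hypothesis Mu : forall n a, M a -> L n (a * u n).

(** The sum of the ideals F_n L_n[X] for n from 1 to K. *)
Fixpoint euclid_sum K : set {poly A} :=
  if K is K'.+1 then
    [set g | exists w h, [/\ euclid_sum K' w, poly_in (L K) h & g = w + F K * h]]
  else [set 0].

Lemma euclid_sum_ideal K : is_ideal (euclid_sum K).
Proof.
elim: K => [|K IHK]; first exact: zero_ideal.
have hLK := poly_in_ideal (hL K.+1).
split=> [|a _ _ [w [h [Nw Lh ->]]] [w' [h' [Nw' Lh' ->]]]].
  by exists 0, 0; split; [exact: submod0 IHK|exact: submod0 hLK|rewrite mulr0 addr0].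
exists (a * w + w'), (a * h + h'); split.
- by apply: (submodD IHK) => //; apply: ideal_mull.
- by apply: (submodD hLK) => //; apply: (ideal_mull a hLK).
- by rewrite [_ *: _]mulrDr !mulrDr addrACA [F _ * (a * h)]mulrCA.
Qed.

Lemma euclid_sumS K : (euclid_sum K `<=` euclid_sum K.+1)%classic.
Proof.
move=> g Ng; exists g, 0; rewrite mulr0 addr0; split=> //.
exact: submod0 (poly_in_ideal (hL _)).
Qed.

Lemma euclid_sum_mono K K' : (K <= K')%N -> (euclid_sum K `<=` euclid_sum K')%classic.
Proof.
move/subnK=> <-; elim: (K' - K)%N => // j IHj g /IHj; exact: euclid_sumS.
Qed.

Lemma euclid_sum_sub K : (euclid_sum K `<=` poly_in (L K))%classic.
Proof.
elim: K => [|K IHK] g; first by move=> /= ->; exact: submod0 (poly_in_ideal (hL _)).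
move=> [w [h [/IHK Lw Lh ->]]]; apply: (submodD (poly_in_ideal (hL _))).
  exact: sub_poly_in (@Lmono K) _ Lw.
exact: (ideal_mull _ (poly_in_ideal (hL _))).
Qed.

(** Cancelling the monic F_(K+1) shows that the last cofactor h has coefficients in L_K, so F_(K+1)
    h = F_K (f_K h) can be absorbed into the summand of index K. For K = 0 there is no such summand,
    but L_0 = 0 gives h = 0. *)
Lemma euclid_sum_strict K g :
  poly_in (L K) g -> euclid_sum K.+1 g -> euclid_sum K g.
Proof.
move=> Lg [w [h [Nw _ gE]]]; have hLK := poly_in_ideal (hL K).
have Lh : poly_in (L K) h.
  apply: (poly_in_monicM (hL K) (euclid_prod_monic K.+1)) => i _.
  suff : poly_in (L K) (F K.+1 * h) by [].
  have -> : F K.+1 * h = g - w by rewrite gE addrC addKr.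
  by apply: (submodB hLK) => //; exact: euclid_sum_sub.
case: K w h g Lg Nw gE hLK Lh => [|K] w h g Lg Nw gE hLK Lh.
  rewrite gE (_ : h = 0) ?mulr0 ?addr0 //.
  by apply/polyP => i; have := Lh i; rewrite L0 coef0.
case: Nw => w' [h' [Nw' Lh' wE]]; exists w', (h' + fac K.+1 * h); split=> //.
  by apply: (submodD hLK) => //; apply: (ideal_mull _ hLK).
by rewrite mulrDr addrA -wE mulrA -/(F K.+2).
Qed.

Definition euclid_union : set {poly A} := [set g | exists K, euclid_sum K g].

Lemma euclid_union_ideal : is_ideal euclid_union.
Proof.
split=> [|a x y [i Ni] [j Nj]]; first by exists 0%N.
exists (maxn i j); have [_] := euclid_sum_ideal (maxn i j); apply.
  exact: euclid_sum_mono (leq_maxl _ _) _ Ni.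
exact: euclid_sum_mono (leq_maxr _ _) _ Nj.
Qed.

Lemma euclid_union_sub K g : poly_in (L K) g -> euclid_union g -> euclid_sum K g.
Proof.
move=> Lg [j /(euclid_sum_mono (leq_addl K j))].
elim: j => [|j IHj]; first by rewrite addn0.
rewrite addnS => Ng; apply/IHj/euclid_sum_strict => //.
apply: sub_poly_in Lg; elim: j {IHj Ng} => [|j IHj] x; first by rewrite addn0.
by rewrite addnS => /IHj; exact: Lmono.
Qed.

(** Membership can be tested in the partial sum n + 1; cancelling F_n leaves u_n - f_n h in L_n[X].
    Since u_n is constant and f_n has positive degree, the coefficients in positive degrees already
    force h into L_n[X], and the constant one then gives u_n in L_n. *)
Lemma euclid_union_nonmember n : ~ euclid_union (F n * (u n)%:P).
Proof.
have hLn := poly_in_ideal (hL n).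
move/euclid_union_sub => /(_ n.+1) []; first apply: (ideal_mull _ (poly_in_ideal (hL _))).
  exact: poly_inC.
move=> w [h [/euclid_sum_sub Lw _ e]].
have Lfh : poly_in (L n) ((u n)%:P - fac n * h).
  apply: (poly_in_monicM (hL n) (euclid_prod_monic n)) => i _.
  suff : poly_in (L n) (F n * ((u n)%:P - fac n * h)) by [].
  by rewrite mulrBr e mulrA -/(F n.+1) addrK.
have [f1 fs] := euclid_factor_monic (euclid_prod_monic n).
have Lh : poly_in (L n) h.
  apply: (poly_in_monicM (hL n) f1) => -[|i] hi.
    by move: hi; rewrite leqNgt -ltnS prednK ?fs // ltnW.
  have := Lfh i.+1; rewrite coefB coefC /= sub0r.
  by move/(submodN (M := A^o) (hL n)); rewrite opprK.
apply: (nLu (n := n)); have := Lfh 0%N; rewrite coefB coefC /= => Lf0.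
apply: (submod_subr (M := A^o) (hL n) Lf0).
suff : poly_in (L n) (fac n * h) by [].
exact: (ideal_mull _ hLn).
Qed.

Lemma poly_not_weakly_laskerian : ~ weakly_laskerian_ring {poly A}.
Proof.
have hN := euclid_union_ideal.
have /choice[h hP] n :
    exists h, is_prime (colon euclid_union (h * (F n * (u n)%:P))).
  apply: (assoc_monic_torsion hM Minv hN (euclid_union_nonmember (n := n))
            _ (euclid_factor_monic (euclid_prod_monic n)).1) => [a Ma|].
    (* Since a u_n is in L_n, the product lies in F_n L_n[X]; for n = 0 it is zero. *)
    rewrite mulrCA -polyCM; case: n => [|n]; last first.
      exists n.+1; exists 0, (a * u n.+1)%:P; rewrite add0r; split=> //.
        exact: submod0 (euclid_sum_ideal _).
      by apply: poly_inC => //; exact: Mu.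
    have := Mu 0 Ma; rewrite L0 => /= ->; rewrite polyC0 mulr0.
    exact: submod0 hN.
  exists n.+1; exists 0, (u n)%:P; split; first exact: submod0 (euclid_sum_ideal _).
    exact: poly_inC.
  by rewrite add0r mulrA [fac n * _]mulrC.
have fP n : colon euclid_union (h n * (F n * (u n)%:P)) (fac n).
  rewrite /colon /= mulrCA; apply: ideal_mull => //.
  exists n.+1; exists 0, (u n)%:P; split; first exact: submod0 (euclid_sum_ideal _).
    exact: poly_inC.
  by rewrite add0r mulrA [fac n * _]mulrC.
apply: (not_weakly_laskerian hN hP) => i j ij.
by apply: (prime_euclid_factor (hP i)) => //; rewrite ij.
Qed.

End PolynomialConstruction.

(** * An ideal of the power series ring with infinitely many associated primes *)

Lemma coef_seriesM (A : comNzRingType) (f g : power_series A) n :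
  (f * g) n = \sum_(i < n.+1) f i * g (n - i)%N.
Proof. by []. Qed.

Lemma coef0_seriesM (A : comNzRingType) (f g : power_series A) :
  (f * g) 0%N = f 0%N * g 0%N.
Proof. by rewrite coef_seriesM big_ord_recl big_ord0 addr0. Qed.

Section PowerSeriesConstruction.
Context {A : comNzRingType}.
Variables (L : nat -> set A) (u : nat -> A) (idx : nat -> nat).
Variables (r : nat -> A) (Q : nat -> set A).
Hypotheses (hL : forall n, is_ideal (L n)) (Lmono : forall n, (L n `<=` L n.+1)%classic).
Hypotheses (Lu : forall n, L n.+1 (u n)).
Hypotheses (hQ : forall i, is_prime (Q i)) (Qinj : injective Q).
Hypothesis QE : forall i a, Q i a <-> forall n, idx n = i -> L n (a * (r i * u n)).

Definition series_in : set (power_series A) := [set f | forall n, L n (f n)].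

Lemma series_chain_mono i j : (i <= j)%N -> (L i `<=` L j)%classic.
Proof. by move/subnK=> <-; elim: (j - i)%N => // k IHk x /IHk; exact: Lmono. Qed.

(** The chain must increase: the coefficient of a product at n involves elements of all L_i with i
    <= n. *)
Lemma series_in_ideal : is_ideal series_in.
Proof.
split=> [n|a f g Lf Lg n]; first exact: submod0 (hL n).
apply: (submodD (M := A^o) (hL n)) => //; apply: (submod_sum (hL n)) => i _.
by apply: ideal_mull => //; exact: series_chain_mono (leq_subr i n) _ (Lf _).
Qed.

Definition series_term i : power_series A :=
  fun n => if idx n == i then r i * u n else 0.

(** The coefficient of [series_term i] at n lies in L_(n+1), so a shift by a positive power of X
    lands in the ideal and only the constant term of the multiplier counts. *)
Lemma series_colonE i : colon series_in (series_term i) = [set f | Q i (f 0%N)]%classic.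
Proof.
have termL n : L n.+1 (series_term i n).
  by rewrite /series_term; case: ifP => _; [exact: ideal_mull|exact: submod0 (hL _)].
have coefE (f : power_series A) n : exists2 t, L n t &
    (f * series_term i) n = f 0%N * series_term i n + t.
  exists (\sum_(j < n) f j.+1 * series_term i (n - j.+1)%N).
    apply: (submod_sum (hL n)) => j _; apply: ideal_mull => //.
    by apply: series_chain_mono (termL _); rewrite -subSn // subSS leq_subr.
  by rewrite coef_seriesM big_ord_recl subn0.
apply/seteqP; split=> f.
  move=> Nf; apply/QE => n ni; have := Nf n; have [t Lt ->] := coefE f n.
  rewrite /series_term ni eqxx -{1}[t]opprK => /(submod_subr (M := A^o) (hL n)).
  by apply; apply: (submodN (M := A^o) (hL n)).
move=> /QE Qf n; have [t Lt ->] := coefE f n.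
apply: (submodD (M := A^o) (hL n)) => //; rewrite /series_term; case: eqP => [/Qf //|_].
by rewrite mulr0; exact: submod0 (hL n).
Qed.

Lemma power_series_not_weakly_laskerian : ~ weakly_laskerian_ring (power_series A).
Proof.
apply: (@not_weakly_laskerian _ series_in series_term series_in_ideal).
  move=> i; split; first exact: colon_ideal series_in_ideal.
    by rewrite series_colonE /=; case: (hQ i).
  by rewrite series_colonE /= => f g; rewrite coef0_seriesM; case: (hQ i) => _ _; apply.
move=> i j; rewrite !series_colonE => e; apply: Qinj; apply/funext => a.
pose cst : power_series A := fun n => if n == 0%N then a else 0.
exact: (congr1 (fun S : set (power_series A) => S cst) e).
Qed.

End PowerSeriesConstruction.

(** * Sequences obtained by choice *)

Lemma infinite_set_injection (T : pointedType) (A : set T) : infinite_set A ->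
  exists f : nat -> T, injective f /\ forall n, A (f n).
Proof.
move=> /infiniteP/pcard_leP[f]; exists f.
split=> [i j|n]; first by apply: inj; rewrite inE.
exact: (@funS _ _ _ _ f n I).
Qed.

Lemma dependent_sequence (X : Type) (S : nat -> X -> X -> Prop) (x0 : X) :
  (forall n x, exists y, S n x y) -> exists f : nat -> X, forall n, S n (f n) (f n.+1).
Proof.
move=> SE; have /choice[F hF] (nx : nat * X) : exists y, S nx.1 nx.2 y by exact: SE.
by exists (nat_rect (fun=> X) x0 (fun n x => F (n, x))) => n; exact: (hF (n, _)).
Qed.

(** * Ideals and primes of the idealization *)

Section Idealization.
Context {R : comNzRingType} {E : lmodType R}.
Local Notation S := (idealization E).

(** Fixes the type [S], so that operations are read in the idealization. *)
Definition idealization_pair (a : R) (e : E) : S := (a, e).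
Local Notation pair := idealization_pair.

Lemma idealization_mulE (s t : S) : s * t = pair (s.1 * t.1) (s.1 *: t.2 + t.1 *: s.2).
Proof. by []. Qed.

Lemma idealization_pairD a b e f : pair a e + pair b f = pair (a + b) (e + f).
Proof. by []. Qed.

Lemma idealization_pairMr a (s : S) : pair a 0 * s = pair (a * s.1) (a *: s.2).
Proof. by rewrite idealization_mulE /= scaler0 addr0. Qed.

Lemma idealization_mul0 (s : S) e : s * pair 0 e = pair 0 (s.1 *: e).
Proof. by rewrite idealization_mulE /= mulr0 scale0r addr0. Qed.

Definition lift_ideal (q : set R) : set S := [set s | q s.1].

Definition lift_submod (T : set E) : set S := [set s | s.1 = 0 /\ T s.2].

Lemma lift_ideal_ideal q : is_ideal q -> is_ideal (lift_ideal q).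
Proof. by case=> q0 qZ; split=> // a x y; exact: qZ. Qed.

Lemma lift_ideal_prime q : is_prime q -> is_prime (lift_ideal q).
Proof.
move=> [hq q1 qM]; split; [exact: lift_ideal_ideal|exact: q1|].
by move=> a b; exact: qM.
Qed.

Lemma lift_ideal_inj : injective lift_ideal.
Proof.
move=> p q pq; apply/funext => a.
exact: (congr1 (fun P : set S => P (pair a 0)) pq).
Qed.

Lemma lift_submod_ideal T : is_submod T -> is_ideal (lift_submod T).
Proof.
move=> hT; split=> [|a x y [x0 Tx] [y0 Ty]]; first by split=> //; exact: submod0 hT.
split; first by change (a.1 * x.1 + y.1 = 0); rewrite x0 y0 mulr0 addr0.
change (T (a.1 *: x.2 + x.1 *: a.2 + y.2)); rewrite x0 scale0r addr0.
by apply: (submodD hT) => //; apply: (submodZ hT).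
Qed.

(** Each (0, e) has square zero and so lies in P; membership thus depends on the first component
    alone. *)
Lemma prime_idealizationE (P : set S) : is_prime P ->
  exists2 q, is_prime q & P = lift_ideal q.
Proof.
move=> [hP P1 PM].
have P0 e : P (pair 0 e).
  have : P (pair 0 e * pair 0 e).
    by rewrite idealization_mul0 scale0r; exact: submod0 hP.
  by case/PM.
have sE (s : S) : s = pair s.1 0 + pair 0 s.2.
  by case: s => a e; congr (_, _); rewrite /= ?addr0 ?add0r.
exists [set a | P (pair a 0)]%classic.
  split=> [||a b]; last first.
  - move=> Pab; apply: (PM (pair a 0) (pair b 0)).
    by rewrite idealization_pairMr scaler0.
  - exact: P1.
  split=> [|a x y Px Py]; first exact: submod0 hP.
  suff : P (pair a 0 * pair x 0 + pair y 0).
    by rewrite idealization_pairMr scaler0 idealization_pairD addr0.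
  by apply: (submodD hP) => //; apply: ideal_mull.
apply/seteqP; split=> s; rewrite /lift_ideal /= => Ps.
  have -> : pair s.1 0 = s - pair 0 s.2 by rewrite {2}[s]sE addrK.
  exact: (submodB hP).
by rewrite [s]sE; apply: (submodD hP).
Qed.

End Idealization.

(** * The three statements for the idealization of E *)

Section Main.
Context {R : comNzRingType} (m : idealr R) {E : lmodType R}.
Variable iota : {linear residue_module m -> E}.
Hypotheses (hR : noetherian R) (hlocal : local_ring m).
Hypothesis hE : injective_envelope iota.

Local Notation mm := [set x | x \in m]%classic.
Local Notation S := (idealization E).
Local Notation pair := (@idealization_pair R E).

Lemma idealization_weakly_laskerian : weakly_laskerian_ring S.
Proof.
have hm := noetherian_local hR hlocal.
move=> N; have hN := submodClosed_submod N; set NN := [set x | x \in N]%classic in hN.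
pose I := [set a | exists e, NN (pair a e)]%classic.
have hI : is_ideal I.
  split=> [|a x y [e Ne] [f Nf]]; first by exists 0; exact: submod0 hN.
  exists (a *: e + f); have -> : pair (a *: (x : R^o) + y) (a *: e + f) =
      pair a 0 * pair x e + pair y f by rewrite idealization_pairMr.
  by apply: (submodD hN) => //; apply: ideal_mull.
pose pr (P : set S) : pred S := [pred s | `[< P s >]].
apply: (@sub_finite_set _ _ [set pr (lift_ideal q) | q in assoc I `|` [set mm]]%classic);
  last first.
  apply: finite_image; rewrite finite_setU; split; first exact: finite_assoc.
  exact: finite_set1.
move=> p /AssP[hp [y py]]; set P := [set` p]%classic in hp.
have PE : P = colon NN y by apply/seteqP; split=> s /py.
have [q hq Pq] := prime_idealizationE hp; exists q; last first.
  apply/funext => s; rewrite /pr /=; have : P s = lift_ideal q s by rewrite Pq.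
  by move=> <-; rewrite /P /= asboolb.
(* If some multiple of y outside N is congruent to a pair (0, e), it still has annihilator P, and
   the torsion of e puts a power of each c in m into q. *)
have [[s [e [Ns sN]]]|noE] :=
    pselect (exists s e, NN (s * y - pair 0 e) /\ ~ NN (s * y)).
  right; apply/seteqP; split; first exact: prime_sub_local hm _ hq.
  move=> c mc; have [k cke] := envelope_torsion hR hlocal hE e mc.
  apply: (is_primeX (n := k) hq); have Ps : ~ P s by rewrite PE.
  have : lift_ideal q (pair (c ^+ k) 0); last by [].
  rewrite -Pq (prime_colonM hp PE hN Ps) /colon /=.
  rewrite -[s * y](subrK (pair 0 e)) mulrDr; apply: (submodD hN); first exact: ideal_mull.
  by rewrite idealization_mul0 /= cke; exact: submod0 hN.
left; split=> //; exists y.1.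
have qE a : q a = NN (pair a 0 * y).
  by have <- : colon NN y (pair a 0) = NN (pair a 0 * y) by []; rewrite -PE Pq.
apply/seteqP; split=> a; rewrite qE.
  by rewrite idealization_pairMr => Na; exists (a *: y.2).
(* If a y_1 is in I, then a y is congruent modulo N to a pair (0, e'), so it lies in N in this
   case. *)
move=> [e Ne]; apply: contrapT => Nay; apply: noE.
exists (pair a 0), (a *: y.2 - e); split=> //.
suff -> : pair a 0 * y - pair 0 (a *: y.2 - e) = pair (a * y.1) e by [].
by rewrite idealization_pairMr; congr (_, _); rewrite /= ?subr0 // subKr.
Qed.

(** The elements killed by the n-th power of m, without forming that power. *)
Fixpoint socle_filtration n : set E :=
  if n is n'.+1 then [set e | forall a, a \in m -> socle_filtration n' (a *: e)]
  else [set 0].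

Lemma socle_filtration_submod n : is_submod (socle_filtration n).
Proof.
elim: n => [|n IHn]; first by split=> // a x y /= -> ->; rewrite scaler0 addr0.
split=> [a _|a x y mx my b mb]; first by rewrite scaler0; exact: submod0 IHn.
rewrite scalerDr scalerA mulrC -scalerA; apply: (submodD IHn); last exact: my.
by apply: (submodZ IHn); exact: mx.
Qed.

Lemma socle_filtrationS n : (socle_filtration n `<=` socle_filtration n.+1)%classic.
Proof.
by move=> e ne a _; apply: (submodZ (socle_filtration_submod n)).
Qed.

(** With c in m outside p, c^n kills L_n but not E, so L_n is not all of E. An x with maximal
    annihilator modulo L_n works: if b in m had b x outside L_n, then no b^k x would lie in L_n,
    against torsion. *)
Lemma socle_filtration_strict p n : is_prime p -> p <> mm ->
  exists e, socle_filtration n.+1 e /\ ~ socle_filtration n e.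
Proof.
move=> hp pm; have hm := noetherian_local hR hlocal.
have [c mc pc] := prime_nonmember hm hp pm.
have cn e : socle_filtration n e -> c ^+ n *: e = 0.
  elim: n e => [|n IHn] e; first by move=> /= ->; rewrite scaler0.
  by move=> ne; rewrite exprSr -scalerA; apply/IHn/ne.
have [||e [_ e0]] := envelope_cogenerator hR hlocal hE (I := p) (r := c ^+ n).
- by case: hp.
- by move/(is_primeX hp).
have hn := socle_filtration_submod n.
pose ann x : set R := [set a | socle_filtration n (a *: x)]%classic.
have [||_ [[x nx <-] Jmax]] := @noetherian_max _ hR
  [set ann x | x in [set x | ~ socle_filtration n x]]%classic (ann e).
- by exists e => // /cn.
- move=> _ [x _ <-]; split=> [|a u v].
    by rewrite /ann /= scale0r; exact: submod0 hn.
  rewrite /ann /= => nu nv; rewrite scalerDl -scalerA.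
  by apply: (submodD hn) => //; apply: (submodZ hn).
exists x; split=> // b mb; apply: contrapT => nbx.
have annE : ann (b *: x) = ann x.
  apply: Jmax; first by exists (b *: x).
  by move=> a ax; rewrite /ann /= scalerA mulrC -scalerA; apply: (submodZ hn).
have [k] := envelope_torsion hR hlocal hE x mb.
have : ~ socle_filtration n (b ^+ k *: x); last first.
  by move=> nk k0; apply: nk; rewrite k0; exact: submod0 hn.
elim: k => [|k IHk]; first by rewrite expr0 scale1r.
rewrite exprSr -scalerA => bk; apply: IHk.
have : ann (b *: x) (b ^+ k) by [].
by rewrite annE.
Qed.

Lemma idealization_poly_not_weakly_laskerian p : is_prime p -> p <> mm ->
  ~ weakly_laskerian_ring {poly S}.
Proof.
move=> hp pm; have [hmi m1 _] := noetherian_local hR hlocal.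
have /choice[u hu] n := socle_filtration_strict n hp pm.
apply: (@poly_not_weakly_laskerian _ (lift_ideal mm)
  (fun n => lift_submod (socle_filtration n)) (fun n => pair 0 (u n))).
- exact: lift_ideal_ideal.
- move=> a /(local_inv (noetherian_local hR hlocal))[b ba]; exists (pair b 0).
  have -> : lift_ideal mm (1 - pair b 0 * a) = mm (1 - b * a.1) by [].
  by rewrite ba subrr; exact: submod0 hmi.
- by move=> n; apply/lift_submod_ideal/socle_filtration_submod.
- by apply/seteqP; split=> [[a e] [/= -> ->]|_ ->].
- by move=> n s [s0 /socle_filtrationS sn].
- by move=> n; split=> //; exact: (hu n).1.
- by move=> n [_]; exact: (hu n).2.
- by move=> n a ma; rewrite idealization_mul0; split=> //; exact: (hu n).1.
Qed.

(** The exponent is uniform in x, so an element that survives a large enough power of c must lie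
    outside T. *)
Definition bounded_torsion (T : set E) : Prop :=
  is_submod T /\ forall c, c \in m -> exists k, forall x, T x -> c ^+ k *: x = 0.

(** With c^l T = 0, take e killed by p but not by c^(l+k), and T' = T + R e. Then c^k e in T would
    give c^(l+k) e = 0. *)
Lemma bounded_torsion_extend T p c k : bounded_torsion T -> is_prime p ->
  c \in m -> ~ p c -> exists T', [/\ bounded_torsion T', (T `<=` T')%classic &
    exists e, [/\ T' e, forall a, p a -> a *: e = 0 & ~ T (c ^+ k *: e)]].
Proof.
move=> [hT Tt] hp mc pc; have [l Tl] := Tt c mc.
have [||e [pe e0]] := envelope_cogenerator hR hlocal hE (I := p) (r := c ^+ (l + k)).
- by case: hp.
- by move/(is_primeX hp).
exists [set x | exists a, T (x - a *: e)]%classic; split.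
- split.
    split=> [|b x y [a Ta] [a' Ta']].
      by exists 0; rewrite scale0r subr0; exact: submod0 hT.
    exists (b * a + a'); rewrite scalerDl opprD addrACA -scalerA -scalerBr.
    by apply: (submodD hT) => //; apply: (submodZ hT).
  move=> d md; have [i Ti] := Tt d md.
  have [j de] := envelope_torsion hR hlocal hE e md.
  exists (i + j)%N => x [a /Ti Tx]; rewrite -[x](subrK (a *: e)) scalerDr.
  rewrite {1}addnC exprD -scalerA Tx scaler0 add0r exprD.
  by rewrite scalerA mulrC mulrA -scalerA [d ^+ j *: e]de scaler0.
- by move=> x Tx; exists 0; rewrite scale0r subr0.
- exists e; split=> //; first by exists 1; rewrite scale1r subrr; exact: submod0 hT.
  by move=> /Tl; rewrite scalerA -exprD.
Qed.

Lemma bounded_torsion0 : bounded_torsion [set 0].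
Proof.
split; first exact: socle_filtration_submod 0%N.
by move=> c _; exists 0%N => x ->; rewrite scaler0.
Qed.

Lemma idealization_series_not_weakly_laskerian :
  infinite_set [set P | coheight_one mm P]%classic ->
  ~ weakly_laskerian_ring (power_series S).
Proof.
have hm := noetherian_local hR hlocal; have hmi : is_ideal mm by case: hm.
move=> /infinite_set_injection[p [pinj hp]].
have /choice[c hc] i : exists c, c \in m /\ ~ p i c.
  by have [hpi pim _] := hp i; have [c] := prime_nonmember hm hpi pim; exists c.
(* Every pair (i, k) is reached at its code; numbers that are not codes repeat (0, 0). *)
pose idx n : nat * nat := odflt (0, 0)%N (unpickle n).
have [|T hT] := @dependent_sequence {T : set E | bounded_torsion T}
  (fun n T T' => (sval T `<=` sval T')%classic /\
     exists e, [/\ sval T' e, forall a, p (idx n).1 a -> a *: e = 0 &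
       ~ sval T (c (idx n).1 ^+ (idx n).2 *: e)]) (exist _ _ bounded_torsion0).
  move=> n [T bT]; have [mc pc] := hc (idx n).1; have [hpi _ _] := hp (idx n).1.
  have [T' [bT' TT' eT]] := bounded_torsion_extend (idx n).2 bT hpi mc pc.
  by exists (exist _ T' bT').
have /choice[e he] n := (hT n).2.
have hTs n : is_submod (sval (T n)) by case: (svalP (T n)).
(* The annihilator in R of the series y_i modulo the series with n-th coefficient in [T n]. *)
pose I i := [set a | forall n, (idx n).1 = i -> sval (T n) (a *: e n)]%classic.
have hI i : is_ideal (I i).
  split=> [n _|a u v Iu Iv n ni]; first by rewrite scale0r; exact: submod0 (hTs n).
  rewrite scalerDl -scalerA; apply: (submodD (hTs n)); last exact: Iv.
  by apply: (submodZ (hTs n)); exact: Iu.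
(* No power c_i^k lies in [I i], as the coefficient at the code of (i, k) shows. The resulting prime
   contains p_i and omits c_i, so it is not m and must be p_i. *)
have /choice[r hr] i : exists r, p i = colon (I i) r.
  have [|r [rP rc]] := assoc_avoid (c := c i) hR (hI i).
    move=> k /(_ (pickle (i, k))); rewrite /idx pickleK /= => /(_ erefl).
    by have [_ _] := he (pickle (i, k)); rewrite /idx pickleK.
  exists r; have [_ _ pmax] := hp i; apply/esym/pmax => //.
    by move=> rm; apply: rc; rewrite rm; exact: (hc i).1.
  move=> a pa; rewrite /colon /= => n ni; rewrite mulrC -scalerA.
  have [_ pe _] := he n; rewrite pe ?ni // scaler0; exact: submod0 (hTs n).
apply: (@power_series_not_weakly_laskerian _ (fun n => lift_submod (sval (T n)))
  (fun n => pair 0 (e n)) (fun n => (idx n).1) (fun i => pair (r i) 0)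
  (fun i => lift_ideal (p i))).
- by move=> n; apply: lift_submod_ideal.
- by move=> n s [s0 Ts]; split=> //; exact: (hT n).1.
- by move=> n; split=> //; case: (he n).
- by move=> i; apply: lift_ideal_prime; case: (hp i).
- by move=> i j /lift_ideal_inj; exact: pinj.
move=> i s; have sE n : lift_submod (sval (T n)) (s * (pair (r i) 0 * pair 0 (e n))) =
    sval (T n) ((s.1 * r i) *: e n).
  rewrite !idealization_mul0 /= scalerA; apply/propext; split=> [[]//|Ts]; exact: conj.
have -> : lift_ideal (p i) s = colon (I i) (r i) s.1 by rewrite -hr.
by split=> H n ni; [rewrite sE|rewrite -sE]; exact: H.
Qed.

End Main.

Unset Implicit Arguments.

Theorem theorem4p5 (R : comNzRingType) (m : idealr R) (d : nat)
    (E : lmodType R) (iota : {linear residue_module m -> E})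
    (hnoeth : noetherian R) (hlocal : local_ring m) (hdim : krull_dim R d)
    (hE : injective_envelope iota) :
  weakly_laskerian_ring (idealization E) /\
  ((1 <= d)%N -> ~ weakly_laskerian_ring {poly idealization E}) /\
  ((2 <= d)%N -> ~ weakly_laskerian_ring (power_series (idealization E))).
Proof.
have hm := noetherian_local hnoeth hlocal.
split; first exact: idealization_weakly_laskerian hE.
have [[p [hp pS]] _] := hdim.
have {}hp i : (i <= d)%N -> is_prime [set x | x \in p i]%classic.
  by move=> /hp/prime_idealP.
split=> d1.
  (* The bottom prime of the chain is strictly below [p 1], hence is not m. *)
  apply: (idealization_poly_not_weakly_laskerian hnoeth hlocal hE (hp 0%N _)) => // p0.
  have [_] := pS 0%N d1; apply=> x x1.
  have : [set x | x \in p 0%N]%classic x; last by [].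
  by rewrite p0; exact: (prime_sub_local hm (hp 1%N d1)).
apply: (idealization_series_not_weakly_laskerian hnoeth hlocal hE).
have [p01 p10] := pS 0%N (ltnW d1); have [_ p21] := pS 1%N d1.
(* The prime [p 2] serves only to separate [p 1] from m. *)
apply: (infinite_coheight_one hnoeth hm (hp 0%N _) (hp 1%N (ltnW d1))) => //.
  move=> e; apply: p10 => x x1.
  by have : [set x | x \in p 0%N]%classic x; [rewrite e|].
move=> e; apply: p21 => x x2.
have : [set x | x \in p 1%N]%classic x; last by [].
by rewrite e; exact: (prime_sub_local hm (hp 2%N d1)).
Qed.
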